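(* Let $M$ be a matroid on the ground set $E=[n]=\{1,\dots,n\}$ with set of circuits $\mathcal{C}$, and let $C\in\mathcal{C}$ be a circuit of $M$. Then $$\beta_C=\sum_{k=0}^{|\mathcal{C}|-1}\left((-1)^k\cdot\sum_{\substack{S\subseteq\mathcal{C}\setminus\{C\},\\ |S|=k}}\frac{|C|}{\left|\left(\bigcup_{C'\in S}C'\right)\cup C\right|}\right).$$
   Context: Matroid bingo: let $M$ be a matroid on a finite set $E$ with $|E|=n$ and circuit set $\mathcal{C}$. The elements of $E$ are called out one at a time in a uniformly random order $\sigma(1),\sigma(2),\dots,\sigma(n)$ (a uniformly random permutation of $E$). A circuit $C$ wins in round $t$ if $C\subseteq\{\sigma(1),\dots,\sigma(t)\}$ and no circuit of $M$ is contained in $\{\sigma(1),\dots,\sigma(t-1)\}$; thus the winner is the first circuit to be completed (the circuit axioms guarantee that there is no tie). $\beta_C$ denotes the probability that $C$ wins (in some round). *)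

(* Defs.v *)
From mathcomp Require Import all_boot all_order all_fingroup all_algebra.

Set Implicit Arguments.
Unset Strict Implicit.
Unset Printing Implicit Defensive.

Import GRing.Theory.
Local Open Scope ring_scope.

Record matroid (T : finType) := Matroid {
  indep : {set {set T}};
  indep_set0 : set0 \in indep;
  indep_sub : forall I J : {set T}, I \subset J -> J \in indep -> I \in indep;
  indep_aug : forall I J : {set T}, I \in indep -> J \in indep ->
    (#|I| < #|J|)%N -> exists2 x, x \in J :\: I & x |: I \in indep
}.

Definition circuits (T : finType) (M : matroid T) : {set {set T}} :=
  [set C | minset (fun A : {set T} => A \notin indep M) C].

Definition uniform_prob (O : finType) (A : {set O}) : rat :=
  #|A|%:R / #|O|%:R.

(* The ground set {1, ..., n} is encoded as 'I_n. A permutation s of it is a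
   calling order: the elements called in the first t rounds are
   s 0, ..., s (t - 1). *)
Definition called (n : nat) (s : {perm 'I_n}) (t : nat) : {set 'I_n} :=
  [set s i | i : 'I_n & (i < t)%N].

(* Rounds are numbered from 1. *)
Definition wins_in_round (n : nat) (M : matroid 'I_n) (C : {set 'I_n})
    (s : {perm 'I_n}) (t : nat) : bool :=
  (C \subset called s t) &&
  [forall (D | D \in circuits M), ~~ (D \subset called s t.-1)].

Definition beta (n : nat) (M : matroid 'I_n) (C : {set 'I_n}) : rat :=
  uniform_prob [set s : {perm 'I_n} |
                 [exists i : 'I_n, wins_in_round M C s i.+1]].

(* Main.v *)
Require Import Defs.
From mathcomp Require Import all_boot all_order all_fingroup all_algebra.

Set Implicit Arguments.
Unset Strict Implicit.
Unset Printing Implicit Defensive.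

Import GRing.Theory.
Local Open Scope ring_scope.

(** Let x be the last called element of C, and let X be the set of elements
    called up to and including x. By circuit elimination, C wins if and only if
    X contains no other circuit. By inclusion-exclusion, the indicator of this
    event is the sum of (-1)^|S| over the sets S of circuits other than C such
    that the union of S is contained in X, i.e. such that the last called
    element of the union of S and C lies in C. Since every element of a nonempty
    set is equally likely to be its last called one, the probability of the
    latter event is |C| divided by the cardinality of this union. *)

Lemma circuit_neq0 (T : finType) (M : matroid T) (C : {set T}) :
  C \in circuits M -> C != set0.
Proof.
apply: contraTneq => ->; rewrite inE; apply/negP => /minsetp.
by rewrite indep_set0.
Qed.

(** Otherwise [(C :|: D) :\ x] is independent. A largest independent [J] between [C :\ f] and
    [C :|: D], with [f] in [C] outside [D], has fewer elements, so augmentation enlarges it inside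
    [C :|: D], a contradiction. *)
Lemma circuit_elimination (T : finType) (M : matroid T) (C D : {set T}) (x : T) :
  C \in circuits M -> D \in circuits M -> C != D -> x \in C :&: D ->
  exists2 B, B \in circuits M & B \subset (C :|: D) :\ x.
Proof.
rewrite !inE => Cmin Dmin neqCD /andP[xC xD].
have [Idep|] := boolP ((C :|: D) :\ x \notin indep M).
  have [B Bmin sBI] := @minset_exists _ (fun A => A \notin indep M) _ Idep.
  by exists B; rewrite ?inE.
rewrite negbK => Iindep.
have /subsetPn[f fC fND] : ~~ (C \subset D).
  apply: contra neqCD => sCD; apply/eqP/(minsetinf Dmin) => //.
  exact: minsetp Cmin.
have Cf_indep : C :\ f \in indep M.
  apply: contraT => Cf_dep; have := minsetinf Cmin Cf_dep (subsetDl _ _).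
  by move/setP/(_ f); rewrite !inE eqxx fC.
pose P (J : {set T}) := [&& J \in indep M, C :\ f \subset J & J \subset C :|: D].
have P0 : P (C :\ f).
  by rewrite /P Cf_indep subxx (subset_trans (subsetDl _ _)) ?subsetUl.
case: (arg_maxnP (fun J : {set T} => #|J|) P0) => J /and3P[Jindep sCfJ sJCD] Jmax.
have fNJ : f \notin J.
  apply: contraL (minsetp Cmin) => fJ; rewrite negbK; apply: indep_sub Jindep.
  by rewrite -(setD1K fC) subUset sub1set fJ.
have /subsetPn[g gD gNJ] : ~~ (D \subset J).
  by apply: contra (minsetp Dmin) => sDJ; apply: indep_sub Jindep.
have neqgf : g != f by apply: contraTneq gD => ->.
(* [J] misses two distinct elements of [C :|: D], namely [f] and [g], whereas the right-hand set
   misses only [x]. *)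
have cardJI : (#|J| < #|(C :|: D) :\ x|)%N.
  have sJ : J \subset ((C :|: D) :\ f) :\ g.
    by rewrite !subsetD1 sJCD fNJ gNJ.
  apply: leq_ltn_trans (subset_leq_card sJ) _.
  have xCD : x \in C :|: D by rewrite inE xC.
  have fCD : f \in C :|: D by rewrite inE fC.
  have gCD : g \in (C :|: D) :\ f by rewrite !inE neqgf gD orbT.
  have := cardsD1 x (C :|: D); rewrite xCD (cardsD1 f) fCD (cardsD1 g) gCD.
  by rewrite !add1n => -[<-].
have [y /setDP[yI yNJ] yJ] := indep_aug Jindep Iindep cardJI.
suff /Jmax : P (y |: J) by rewrite /= cardsU1 yNJ ltnn.
apply/and3P; split=> //; first exact: subset_trans sCfJ (subsetUr _ _).
by rewrite subUset sub1set sJCD andbT; case/setD1P: yI.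
Qed.

(** Toggling a fixed element of a nonempty [A] pairs its subsets with opposite signs. *)
Lemma sum_subset_sign (R : pzRingType) (T : finType) (A : {set T}) :
  \sum_(S : {set T} | S \subset A) (-1) ^+ #|S| = (A == set0)%:R :> R.
Proof.
have [->|/set0Pn[x xA]] := eqVneq A set0.
  by rewrite (big_pred1 set0) ?cards0 // => S; rewrite subset0.
rewrite (bigID (fun S : {set T} => x \in S)) /=.
rewrite (reindex_onto (fun S => x |: S) (fun S => S :\ x)) /=; last first.
  by move=> S /andP[_ xS]; rewrite setD1K.
rewrite (eq_bigl (fun S : {set T} => (S \subset A) && (x \notin S))) => [|S].
  rewrite -big_split big1 //= => S /andP[_ xNS].
  by rewrite cardsU1 xNS exprS mulN1r addNr.
rewrite subUset sub1set xA setU11 andbT /=; congr (_ && _).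
apply/eqP/idP => [<-|xNS]; first by rewrite !inE eqxx.
by rewrite setU1K.
Qed.

Section CallingOrder.

Variable n : nat.
Implicit Types (s : {perm 'I_n}) (A B C D : {set 'I_n}) (x y : 'I_n).

Lemma mem_called s t x : (x \in called s t) = ((s^-1)%g x < t)%N.
Proof.
apply/imsetP/idP => [[i it ->]|lt].
  by move: it; rewrite inE permK.
by exists ((s^-1)%g x); rewrite ?inE ?permKV.
Qed.

(** Positions start at 0, so the successor makes the called set include [x] itself. *)
Definition last_called s A x :=
  (x \in A) && (A \subset called s ((s^-1)%g x).+1).

Lemma last_calledP s A x :
  reflect (x \in A /\ forall y, y \in A -> ((s^-1)%g y <= (s^-1)%g x)%N)
          (last_called s A x).
Proof.
apply: (iffP andP) => -[xA sub]; split=> //.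
  by move=> y /(subsetP sub); rewrite mem_called.
by apply/subsetP => y /sub; rewrite mem_called.
Qed.

Lemma last_called_exists s A : A != set0 -> exists x, last_called s A x.
Proof.
case/set0Pn => x0 x0A.
case: (arg_maxnP (fun x => (s^-1)%g x : nat) x0A) => x xA xmax.
by exists x; apply/last_calledP.
Qed.

Lemma last_called_inj s A x y : last_called s A x -> last_called s A y -> x = y.
Proof.
move=> /last_calledP[xA xmax] /last_calledP[yA ymax].
apply: (@perm_inj _ (s^-1)%g); apply/val_inj/anti_leq.
by rewrite xmax ?ymax.
Qed.

Lemma sum_last_called s A : A != set0 -> (\sum_(x in A) last_called s A x = 1)%N.
Proof.
move=> /(last_called_exists s)[x lx]; have /andP[xA _] := lx.
rewrite (bigD1 x) //= lx big1 // => y /andP[_ neqyx].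
by case: (boolP (last_called s A y)) => // /last_called_inj/(_ lx)/eqP;
  rewrite (negbTE neqyx).
Qed.

(** Exchanging the names [x] and [y] in the calling order is a bijection on orders, and it preserves
    [A]. *)
Lemma card_last_called_eq A x y : x \in A -> y \in A ->
  (\sum_s last_called s A x = \sum_s last_called s A y)%N.
Proof.
move=> xA yA; rewrite (reindex_inj (mulIg (tperm x y))) /=.
apply: eq_bigr => s _; congr nat_of_bool.
have tA z : (tperm x y z \in A) = (z \in A).
  by case: tpermP => [->|->|//]; rewrite xA yA.
apply/last_calledP/last_calledP => -[_ smax]; split=> // z zA.
  have := smax (tperm x y z).
  by rewrite tA invMg !permM tpermV tpermK tpermL => ->.
by rewrite invMg !permM tpermV tpermL smax ?tA.
Qed.

(** By symmetry each element of [A] is last in the same number [N] of orders. Each order has exactly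
    one last element of [A], so there are [#|A| * N] orders in all, and [N] cancels. *)
Lemma prob_last_called A B : A != set0 -> B \subset A ->
  (\sum_s \sum_(x in B) last_called s A x)%N%:R / #|{perm 'I_n}|%:R
    = #|B|%:R / #|A|%:R :> rat.
Proof.
move=> A0 sBA; have /set0Pn[a aA] := A0.
pose N := (\sum_s last_called s A a)%N.
have sumN (D : {set 'I_n}) : D \subset A ->
    (\sum_s \sum_(x in D) last_called s A x = #|D| * N)%N.
  move=> sDA; rewrite exchange_big -sum_nat_const /=; apply: eq_bigr => x xD.
  exact: card_last_called_eq (subsetP sDA x xD) aA.
have cardN : (#|{perm 'I_n}| = #|A| * N)%N.
  rewrite -sumN // (eq_bigr (fun=> 1%N)) => [|s _]; last exact: sum_last_called.
  by rewrite sum1_card.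
have N0 : N != 0%N.
  have : (0 < #|{perm 'I_n}|)%N by apply/card_gt0P; exists 1%g.
  by rewrite cardN muln_gt0 => /andP[_]; rewrite lt0n.
rewrite sumN // cardN !natrM -mulf_div divff ?mulr1 //.
by rewrite Num.Theory.pnatr_eq0.
Qed.

(** Another circuit called by the round of [x] spoils the win: if it avoids [x], it was complete
    earlier; if it contains [x], eliminating [x] against [C] yields a circuit that was complete
    earlier. *)
Lemma winsE (M : matroid 'I_n) C s x : C \in circuits M -> last_called s C x ->
  [exists i : 'I_n, wins_in_round M C s i.+1] =
  ([set D in circuits M :\ C | D \subset called s ((s^-1)%g x).+1] == set0).
Proof.
move=> hC lx; have /andP[xC sCx] := lx.
have called_before D : D \subset called s ((s^-1)%g x).+1 -> x \notin D ->
    D \subset called s ((s^-1)%g x).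
  move=> /subsetP sD xND; apply/subsetP => y yD.
  have := sD y yD; rewrite !mem_called ltnS leq_eqVlt => /orP[/eqP|//].
  by move/val_inj/perm_inj => eyx; rewrite -eyx yD in xND.
apply/existsP/eqP => [[i /andP[sCi /forall_inP noD]]|no_other].
  (* The winning round is that of [x]: not earlier, since [C] must be complete, and not later, since
     [C] is itself one of the circuits that must not be complete before. *)
  have eqi : (s^-1)%g x = i :> nat.
    apply/anti_leq; rewrite -ltnS -mem_called (subsetP sCi) //=.
    rewrite leqNgt; apply: contra (noD C hC) => ltxi.
    by apply: subset_trans sCx _; apply/subsetP => y;
      rewrite !mem_called /= => /leq_trans->.
  rewrite /= -eqi in noD.
  apply/setP => D; rewrite !inE; apply/negP => /andP[/andP[neqDC Dmin] sDx].
  have hD : D \in circuits M by rewrite inE.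
  have [xD|/(called_before D sDx)] := boolP (x \in D); last first.
    by apply/negP/noD.
  have xCD : x \in D :&: C by rewrite inE xD.
  have [B hB sB] := circuit_elimination hD hC neqDC xCD.
  move/negP: (noD B hB); apply; move: sB; rewrite subsetD1 => /andP[sB xNB].
  by apply: called_before => //; apply: subset_trans sB _; rewrite subUset sDx.
exists ((s^-1)%g x); rewrite /wins_in_round sCx /=.
apply/forall_inP => D hD; apply/negP => sDx.
have neqDC : D != C.
  apply: contraTneq sDx => ->; apply/subsetPn; exists x => //.
  by rewrite mem_called ltnn.
move/setP/(_ D): no_other; rewrite in_set in_setD1 neqDC hD in_set0 /=.
move/negP; apply; apply: subset_trans sDx _.
by apply/subsetP => y; rewrite !mem_called => /ltnW.
Qed.

Lemma wins_inclusion_exclusion (M : matroid 'I_n) C s : C \in circuits M ->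
  [exists i : 'I_n, wins_in_round M C s i.+1]%:R =
  \sum_(S : {set {set 'I_n}} | S \subset circuits M :\ C)
    (-1) ^+ #|S| * (\sum_(x in C) last_called s (\bigcup_(D in S) D :|: C) x)%N%:R
  :> rat.
Proof.
move=> hC; have [x lx] := last_called_exists s (circuit_neq0 hC).
have /andP[xC sCx] := lx.
rewrite (winsE hC lx) -sum_subset_sign big_mkcond [RHS]big_mkcond.
apply: eq_bigr => S _.
(* An element of [C] that is last in the larger union is also last in [C], so only the term of [x]
   can survive. *)
have -> : (\sum_(y in C) last_called s (\bigcup_(D in S) D :|: C) y =
           (\bigcup_(D in S) D \subset called s ((s^-1)%g x).+1))%N.
  move: (\bigcup_(D in S) D) => U.
  rewrite (bigD1 x) //= big1 ?addn0 => [|y /andP[yC neqyx]].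
    by rewrite /last_called inE xC orbT subUset sCx andbT.
  apply/eqP; rewrite eqb0; apply/negP => /andP[_].
  rewrite subUset => /andP[_ sCy].
  have ly : last_called s C y by rewrite /last_called yC.
  by rewrite (last_called_inj ly lx) eqxx in neqyx.
have -> : (S \subset [set D in circuits M :\ C | D \subset called s ((s^-1)%g x).+1])
    = (S \subset circuits M :\ C) &&
      (\bigcup_(D in S) D \subset called s ((s^-1)%g x).+1).
  apply/subsetP/andP => [sS|[/subsetP sSP /bigcupsP sSx]].
    split; first by apply/subsetP => D /sS; rewrite inE => /andP[].
    by apply/bigcupsP => D /sS; rewrite inE => /andP[].
  by move=> D DS; rewrite inE sSP ?sSx.
by case: (S \subset _); case: (_ \subset _); rewrite ?mulr1 ?mulr0.
Qed.

End CallingOrder.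

Theorem theorem1 (n : nat) (M : matroid 'I_n) (C : {set 'I_n})
    (hC : C \in circuits M) :
  beta M C =
    \sum_(0 <= k < #|circuits M|)
      ((-1) ^+ k *
       \sum_(S : {set {set 'I_n}} | (S \subset circuits M :\ C) && (#|S| == k))
         (#|C|%:R / #|(\bigcup_(D in S) D) :|: C|%:R)).
Proof.
transitivity (\sum_(S : {set {set 'I_n}} | S \subset circuits M :\ C)
    (-1) ^+ #|S| * (#|C|%:R / #|(\bigcup_(D in S) D) :|: C|%:R) : rat).
  (* The winning orders are counted by indicators; after exchanging the sums, each [S] contributes
     one last-call probability. *)
  rewrite /beta /uniform_prob -sum1_card natr_sum big_mkcond /=.
  under eq_bigr => s _ do
    rewrite inE -mulrb (wins_inclusion_exclusion s hC).
  rewrite exchange_big mulr_suml /=; apply: eq_bigr => S _.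
  rewrite -mulr_sumr -natr_sum -mulrA; congr (_ * _).
  apply: prob_last_called; last exact: subsetUr.
  by apply: contra (circuit_neq0 hC); rewrite setU_eq0 => /andP[].
rewrite big_mkord; under [RHS]eq_bigr => k _ do rewrite mulr_sumr.
rewrite [RHS](exchange_big_dep (fun S : {set {set 'I_n}} =>
  S \subset circuits M :\ C)) /=; last by move=> k S _ /andP[].
apply: eq_bigr => S sSP.
(* [S] omits the circuit [C], so its size lies in the range of [k]. *)
have ltSk : (#|S| < #|circuits M|)%N.
  by rewrite [ltnRHS](cardsD1 C) hC ltnS subset_leq_card.
by rewrite (big_pred1 (Ordinal ltSk)) // => k; rewrite sSP eq_sym.
Qed.
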